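(* Let $\mathbf n=(n_k)_{k\ge0}$ be a strictly increasing sequence of positive integers, $\mathcal N=\{n_k:k\ge0\}$ and $c_\infty(\mathbf n)=\limsup_{k\to\infty}n_{k+1}/n_k$. If $c_\infty(\mathbf n)<\infty$, then $$\alpha(\mathcal N)\ge2\sin\frac{\pi}{c_\infty(\mathbf n)+1}.$$ If $c_\infty(\mathbf n)=\infty$, then $\alpha(\mathcal N)=0$. In particular, $$\alpha(\mathcal N)>0\quad\Longleftrightarrow\quad c_\infty(\mathbf n)<\infty .$$
   Context: For $B,t>0$, $h_{\mathcal N}(B,t):=\max\{|1-e^{int}|:n\in\mathcal N,\ nt\le B\}$ (the maximum of the empty set being $0$), and $\alpha(\mathcal N):=\lim_{B\to\infty}\liminf_{t\downarrow0}h_{\mathcal N}(B,t)$; the limit exists by monotonicity in $B$. *)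

(* Defs.v *)
From mathcomp Require Import all_boot all_order all_algebra.
From mathcomp Require Import all_classical all_reals all_analysis.
From mathcomp Require Import complex.
From mathcomp Require Import ring lra.

Set Implicit Arguments.
Unset Strict Implicit.
Unset Printing Implicit Defensive.

Import Order.TTheory GRing.Theory Num.Theory.
Import numFieldNormedType.Exports.

Local Open Scope classical_set_scope.
Local Open Scope ring_scope.

Definition expi (R : realType) (x : R) : R[i] := Complex (cos x) (sin x).

(* [Normc.normc] is the complex modulus with values in [R]; the norm [`|z|] of
   the library is the same number seen in [R[i]]. *)
Definition dist1 (R : realType) (x : R) : R :=
  ComplexField.Normc.normc (1 - expi x).

(* For [0 < t] this [sup] is a maximum over a finite set (see [hN_max]), and
   [sup set0 = 0] (lemma [sup0]). *)
Definition hN (R : realType) (N : set nat) (B t : R) : R :=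
  sup [set dist1 (n%:R * t) | n in [set n | N n /\ n%:R * t <= B]].

Definition liminf_hN (R : realType) (N : set nat) (B : R) : \bar R :=
  limf_einf (fun t : R => (hN N B t)%:E) 0^'+.

(* The limit exists, see [cvg_liminf_hN]. *)
Definition alpha (R : realType) (N : set nat) : \bar R :=
  lim (liminf_hN N B @[B --> +oo%R]).

Definition c_infty (R : realType) (n : nat -> nat) : \bar R :=
  limn_esup (fun k => ((n k.+1)%:R / (n k)%:R : R)%:E).

Lemma dist1_ge0 (R : realType) (x : R) : 0 <= dist1 x.
Proof. by rewrite /dist1; case: (1 - expi x) => a b; exact: sqrtr_ge0. Qed.

Lemma dist1_le2 (R : realType) (x : R) : dist1 x <= 2.
Proof.
rewrite /dist1 /expi /=.
have -> : (2 : R) = Num.sqrt (2 ^+ 2) by rewrite sqrtr_sqr ger0_norm.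
apply: ler_wsqrtr.
have := cos_geN1 x; have := cos2Dsin2 x.
set c := cos x; set s := sin x => cs1 c_geN1.
have -> : (1 - c) ^+ 2 + (0 - s) ^+ 2 = (c ^+ 2 + s ^+ 2) + 1 - 2 * c by ring.
by rewrite cs1; nra.
Qed.

Lemma has_ubound_dist1 (R : realType) (A : set nat) (t : R) :
  has_ubound [set dist1 (n%:R * t) | n in A].
Proof. by exists 2 => _ [n _ <-]; exact: dist1_le2. Qed.

Lemma hN_max (R : realType) (N : set nat) (B t : R) : 0 < t ->
  (exists n, N n /\ n%:R * t <= B) ->
  exists2 n, N n /\ n%:R * t <= B & hN N B t = dist1 (n%:R * t).
Proof.
move=> t0 [n0 [Nn0 n0B]].
have ltb n : n%:R * t <= B -> (n < (Num.truncn (B / t)).+1)%N.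
  move=> nB; rewrite -(ltr_nat R); apply: le_lt_trans (truncnS_gt _).
  by rewrite ler_pdivlMr.
pose P (i : 'I_(Num.truncn (B / t)).+1) := `[< N i /\ (i : nat)%:R * t <= B >].
have P0 : P (Ordinal (ltb _ n0B)) by apply/asboolP.
case: (@Order.TotalTheory.arg_maxP _ R _ _ P
  (fun i => dist1 ((i : nat)%:R * t)) P0) => i /asboolP Pi maxi.
exists i => //; apply/eqP; rewrite eq_le; apply/andP; split.
  apply: ge_sup => [|_ [n [Nn nB] <-]]; first by exists (dist1 ((i : nat)%:R * t)), i.
  by apply: (maxi (Ordinal (ltb _ nB))); apply/asboolP.
by apply: ub_le_sup; [exact: has_ubound_dist1 | exists i].
Qed.

Lemma le_hN (R : realType) (N : set nat) (B B' t : R) :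
  B <= B' -> hN N B t <= hN N B' t.
Proof.
move=> BB'; rewrite {1}/hN.
set E := [set dist1 _ | _ in _].
have subE : E `<=` [set dist1 (n%:R * t) | n in [set n | N n /\ n%:R * t <= B']].
  by move=> _ [n [Nn nB] <-]; exists n => //; split=> //; exact: le_trans nB BB'.
have leE x : E x -> x <= hN N B' t.
  by move=> /subE ?; apply: ub_le_sup => //; exact: has_ubound_dist1.
have [->|/set0P E0] := eqVneq E set0; last exact: ge_sup.
rewrite sup0 /hN; set F := [set dist1 _ | _ in _].
have [->|/set0P[y Fy]] := eqVneq F set0; first by rewrite sup0.
apply: (@le_trans _ _ y); first by case: Fy => n _ <-; exact: dist1_ge0.
by apply: ub_le_sup => //; exact: has_ubound_dist1.
Qed.

Lemma cvg_liminf_hN (R : realType) (N : set nat) :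
  cvg (@liminf_hN R N B @[B --> +oo%R]).
Proof.
apply/cvg_ex; eexists; apply: nondecreasing_cvge => B B' BB'.
rewrite /liminf_hN !limf_einfE; apply: ge_ereal_sup => _ [V FV <-].
apply: (@le_trans _ _ (ereal_inf [set (hN N B' t)%:E | t in V])); last first.
  by apply: ereal_sup_ubound; exists V.
apply: le_ereal_inf_tmp => _ [t Vt <-].
apply: (@le_trans _ _ (hN N B t)%:E); last by rewrite lee_fin le_hN.
by apply: ereal_inf_lbound; exists t.
Qed.

(* Main.v *)
Require Import Defs.
From mathcomp Require Import all_boot all_order all_algebra.
From mathcomp Require Import all_classical all_reals all_analysis.
From mathcomp Require Import complex ring lra.

Import Order.TTheory GRing.Theory Num.Theory.
Import numFieldNormedType.Exports.

Set Implicit Arguments.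
Unset Strict Implicit.
Unset Printing Implicit Defensive.

Local Open Scope classical_set_scope.
Local Open Scope ring_scope.

(** Write [|1 - e^(ix)| = 2 |sin (x/2)|].  The points of the circle at distance
    at least [2 sin a] from [1] are the [e^(ix)] with [2 a <= x <= 2 pi - 2 a]
    modulo [2 pi].  The endpoints of this window have ratio exactly [c] when
    [a = pi / (c + 1)].

    If [n (k+1) <= c * n k] for all large [k], then for small [t] the
    sequence [n k * t] starts below the window and grows by factors at most
    [c], so it cannot jump over the window ([exists_term_between]).  A term
    landing in it is at most [2 pi] and shows [h(B, t) >= 2 sin (pi / (c + 1))]
    for all [B >= 2 pi] and all small [t] ([alpha_ge_of_ratio_le]).  Every
    [c > c_infty] is such an eventual bound, and [c] tends to [c_infty] from
    above by continuity ([alpha_ge_c_infty]).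

    If the ratios are unbounded, fix [B] and a small [d], take [k] with
    [n (k+1) / n k > B / d] and put [t = d / n k].  All terms up to [n k] are
    then mapped into [[0, d]], and all later ones are beyond [B], so that
    [h(B, t)] is small; such [k] being arbitrarily large, these [t] tend to
    [0] ([alpha_eq0_of_ratio_unbounded]).

    The equivalence follows because [c_infty >= 1] puts [pi / (c_infty + 1)]
    in [(0, pi / 2]], where the sine is positive. *)

(** * The distance from 1 on the unit circle *)

Lemma dist1E (R : realType) (x : R) : dist1 x = 2 * `|sin (x / 2)|.
Proof.
have -> : dist1 x = Num.sqrt ((1 - cos x) ^+ 2 + (0 - sin x) ^+ 2) by [].
have {1 2}-> : x = (x / 2) *+ 2 by rewrite -mulr_natr; field.
rewrite cos_mulr2n sin_mulr2n.
have := cos2Dsin2 (x / 2); set c := cos _; set s := sin _ => cs.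
have -> : (1 - (c ^+ 2 *+ 2 - 1)) ^+ 2 + (0 - c * s *+ 2) ^+ 2 = (2 * s) ^+ 2.
  rewrite (_ : _ + _ = 4 * (1 - c ^+ 2) ^+ 2 + 4 * c ^+ 2 * s ^+ 2); last by ring.
  by rewrite (_ : c ^+ 2 = 1 - s ^+ 2); [ring | rewrite -cs addrK].
by rewrite sqrtr_sqr normrM ger0_norm.
Qed.

Lemma dist1_cvg0 (R : realType) : dist1 x @[x --> (0 : R)] --> (0 : R).
Proof.
rewrite (_ : @dist1 R = fun x : R => 2 * `|sin (x / 2)|); last first.
  by apply/funext => x; exact: dist1E.
rewrite [X in _ --> X](_ : 0 = 2 * `|sin (0 / 2 : R)|); last first.
  by rewrite mul0r sin0 normr0 mulr0.
apply: cvgM; first exact: cvg_cst.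
apply: cvg_norm; apply: (@cvg_comp _ _ _ (fun x : R => x / 2) sin).
  by apply: cvgM; [exact: cvg_id | exact: cvg_cst].
exact: continuous_sin.
Qed.

(** On [[0, pi]] the sine is increasing up to [pi / 2] and symmetric about it,
    so over [[a, pi - a]] it is smallest at the endpoints. *)
Lemma ler_sin_between (R : realType) (a x : R) :
  0 <= a -> a <= x <= pi - a -> sin a <= sin x.
Proof.
move=> a0 /andP[ax xa].
have mono y : a <= y <= pi / 2 -> sin a <= sin y.
  move=> /andP[ay yp]; have [//|ya] := leP (sin a) (sin y).
  move: ya; rewrite ltr_sin ?in_itv/=; first by rewrite ltNge ay.
    by apply/andP; split; lra.
  by apply/andP; split; lra.
have [xp|xp] := leP x (pi / 2); first by apply: mono; rewrite ax.
(* [sin x = sin (pi - x)] brings [x] back to the increasing half. *)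
rewrite -[sin x]opprK -sinN -sinDpi; apply: mono.
by apply/andP; split; lra.
Qed.

(** * Bounds on limits inferior and superior along a filter *)

Lemma near_le_limf_einf (T : choiceType) (X : filteredType T) (R : realType)
    (f : X -> \bar R) (F : set_system X) (l : \bar R) :
  (\forall x \near F, (l <= f x)%E) -> (l <= limf_einf f F)%E.
Proof.
move=> lf; rewrite limf_einfE.
apply: (@le_trans _ _ (ereal_inf (f @` [set x | (l <= f x)%E]))); last first.
  by apply: ereal_sup_ubound; exists [set x | (l <= f x)%E].
by apply: le_ereal_inf_tmp => _ [x /= lfx <-].
Qed.

Lemma frequently_limf_einf_le (T : choiceType) (X : filteredType T)
    (R : realType) (f : X -> \bar R) (F : set_system X) (l : \bar R) :
  (forall V, F V -> exists2 x, V x & (f x <= l)%E) -> (limf_einf f F <= l)%E.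
Proof.
move=> fl; rewrite limf_einfE; apply: ge_ereal_sup => _ [V /fl[x Vx fxl] <-].
by apply: le_trans fxl; apply: ereal_inf_lbound; exists x.
Qed.

Lemma limf_esup_lt_near (T : choiceType) (X : filteredType T) (R : realType)
    (f : X -> \bar R) (F : set_system X) (FF : Filter F) (l : \bar R) :
  (limf_esup f F < l)%E -> \forall x \near F, (f x < l)%E.
Proof.
rewrite limf_esupE => /ereal_inf_lt[_ [V FV <-] supl].
apply: filterS FV => x Vx; apply: le_lt_trans supl.
by apply: ereal_sup_ubound; exists x.
Qed.

Lemma lt_limf_esup_frequently (T : choiceType) (X : filteredType T)
    (R : realType) (f : X -> \bar R) (F : set_system X) (l : \bar R) :
  (l < limf_esup f F)%E -> forall V, F V -> exists2 x, V x & (l < f x)%E.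
Proof.
rewrite limf_esupE => lsup V FV.
have : (l < ereal_sup (f @` V))%E.
  by apply: lt_le_trans lsup _; apply: ereal_inf_lbound; exists V.
by move=> /ereal_sup_gt[_ [x Vx <-]]; exists x.
Qed.

(** * The maximum h and its limit *)

Lemma dist1_le_hN (R : realType) (N : set nat) (B t : R) (m : nat) :
  N m -> m%:R * t <= B -> dist1 (m%:R * t) <= hN N B t.
Proof.
by move=> Nm mB; apply: ub_le_sup; [exact: has_ubound_dist1 | exists m].
Qed.

Lemma hN_ge0 (R : realType) (N : set nat) (B t : R) : 0 <= hN N B t.
Proof.
rewrite /hN; set E := [set dist1 _ | _ in _].
have [->|/set0P[y Ey]] := eqVneq E set0; first by rewrite sup0.
apply: (@le_trans _ _ y); first by case: Ey => m _ <-; exact: dist1_ge0.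
by apply: ub_le_sup => //; exact: has_ubound_dist1.
Qed.

Lemma hN_le (R : realType) (N : set nat) (B t e : R) : 0 <= e ->
  (forall m, N m -> m%:R * t <= B -> dist1 (m%:R * t) <= e) -> hN N B t <= e.
Proof.
move=> e0 He; rewrite /hN; set E := [set dist1 _ | _ in _].
have [->|/set0P E0] := eqVneq E set0; first by rewrite sup0.
by apply: ge_sup => // _ [m [Nm mB] <-]; exact: He.
Qed.

Lemma alpha_ge0 (R : realType) (N : set nat) : (0 <= alpha R N)%E.
Proof.
apply: lime_ge; first exact: cvg_liminf_hN.
by apply: nearW => B; apply: near_le_limf_einf; apply: nearW => t;
  rewrite lee_fin hN_ge0.
Qed.

(** * Growth of the ratios of an increasing sequence *)

Section IncreasingSequence.
Variables (R : realType) (n : nat -> nat).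
Hypothesis n_pos : forall k : nat, (0 < n k)%N.
Hypothesis n_incr : forall k : nat, (n k < n k.+1)%N.

Let n_mono : {mono n : i j / (i <= j)%N}.
Proof. by apply: leq_mono; apply: homo_ltn n_incr; exact: ltn_trans. Qed.

Let leq_n k : (k <= n k)%N.
Proof. by elim: k => // k ih; exact: leq_ltn_trans (n_incr k). Qed.

Let nR_gt0 k : 0 < (n k)%:R :> R.
Proof. by rewrite ltr0n. Qed.

(** A sequence that multiplies by at most [c] at each step cannot jump over an
    interval whose endpoints have ratio [c]: the first term [>= s] comes after
    the index [K], so its predecessor is [< s] and obeys the ratio bound. *)
Lemma exists_term_between (c s t : R) (K : nat) : 0 < t ->
  (forall k, (K <= k)%N -> (n k.+1)%:R <= c * (n k)%:R :> R) ->
  (n K)%:R * t < s ->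
  exists k, s <= (n k)%:R * t <= c * s.
Proof.
move=> t0 ratio nKs.
have ex : exists k, s <= (n k)%:R * t.
  exists (Num.truncn (s / t)).+1; rewrite -ler_pdivrMr//.
  apply: le_trans (ltW (truncnS_gt _)) _.
  by rewrite ler_nat leq_n.
case: (ex_minnP ex) => k sk mink.
have Kk : (K < k)%N.
  rewrite ltnNge; apply/negP => kK.
  have : (n k)%:R * t <= (n K)%:R * t by rewrite ler_pM2r// ler_nat n_mono.
  lra.
case: k Kk sk mink => // k Kk sk mink; exists k.+1; rewrite sk/=.
have ks : (n k)%:R * t < s.
  by rewrite ltNge; apply/negP => /mink; rewrite ltnn.
have nk := ratio _ Kk.
have c0 : 0 <= c.
  by rewrite -(pmulr_lge0 _ (nR_gt0 k)); apply: le_trans nk; exact: ler0n.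
apply: (@le_trans _ _ (c * ((n k)%:R * t))); last by rewrite ler_wpM2l// ltW.
by rewrite mulrA ler_pM2r.
Qed.

(** With [a = pi / (c + 1)], the window [[2 a, 2 c a]] is [[2 a, 2 pi - 2 a]];
    half of a term in it lies between [a] and [pi - a]. *)
Lemma alpha_ge_of_ratio_le (c : R) : 0 <= c ->
  (\forall k \near \oo, (n k.+1)%:R / (n k)%:R <= c) ->
  ((2 * sin (pi / (c + 1)))%:E <= alpha R (range n))%E.
Proof.
move=> c0 [K _ ratio].
have pi0 := pi_gt0 R.
pose a : R := pi / (c + 1).
have a0 : 0 < a by rewrite divr_gt0//; lra.
have aE : a * (c + 1) = pi by rewrite mulfVK//; apply/eqP; lra.
apply: lime_ge; first exact: cvg_liminf_hN.
near=> B; apply: near_le_limf_einf; near=> t; rewrite lee_fin.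
have [k /andP[ak kca]] : exists k, 2 * a <= (n k)%:R * t <= c * (2 * a).
  apply: (@exists_term_between _ _ _ K); [near: t; exact: nbhs_right_gt | |].
    by move=> k Kk; rewrite -ler_pdivrMr//; exact: ratio.
  rewrite mulrC -ltr_pdivlMr//; near: t; apply: nbhs_right_lt.
  by rewrite divr_gt0//; lra.
apply: le_trans (@dist1_le_hN R (range n) B t (n k) _ _); last first.
- apply: (@le_trans _ _ (2 * pi)); first by nra.
  by near: B; apply: nbhs_pinfty_ge; exact: num_real.
- by exists k.
rewrite dist1E ler_pM2l//; apply: le_trans (ler_norm _).
apply: ler_sin_between; first exact: ltW.
by apply/andP; split; rewrite -/a; lra.
Unshelve. all: end_near. Qed.

(** A large gap [n k << n (k+1)] is scaled to start at a small [d'] and to end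
    beyond [B]: at this scale every term up to [B] is close to [0]. *)
Lemma alpha_eq0_of_ratio_unbounded :
  (forall (M : R) K, exists2 k, (K <= k)%N & M < (n k.+1)%:R / (n k)%:R) ->
  alpha R (range n) = 0%E.
Proof.
move=> ratio; apply/eqP; rewrite eq_le alpha_ge0 andbT.
apply: lime_le; first exact: cvg_liminf_hN.
apply: nearW => B; apply/lee_addgt0Pr => e e0; rewrite add0e.
have [d /= d0 dist_lt] : \forall x \near (0 : R), dist1 x < e.
  by apply: (cvgr_lt 0 (@dist1_cvg0 R)).
have {}dist_lt x : 0 <= x < d -> dist1 x < e.
  move=> /andP[x0 xd]; apply: dist_lt => /=.
  by rewrite sub0r normrN ger0_norm.
apply: frequently_limf_einf_le => V [r /= r0 rV].
pose d' := d / 2.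
have d'0 : 0 < d' by rewrite divr_gt0.
(* The lower bound on [k] forces [t = d' / n k] into the given neighbourhood
   of [0], of radius [r]. *)
have [k Kk Mk] := ratio (B / d') (Num.truncn (d' / r)).+1.
pose t := d' / (n k)%:R.
have t0 : 0 < t by rewrite divr_gt0.
have kt : (n k)%:R * t = d' by rewrite mulrC divfK// gt_eqF.
exists t.
  apply: rV => //=; rewrite sub0r normrN gtr0_norm// ltr_pdivrMr//.
  rewrite mulrC -ltr_pdivrMr//; apply: (lt_le_trans (truncnS_gt _)).
  by rewrite ler_nat (leq_trans Kk).
rewrite lee_fin; apply: hN_le => [|_ [j _ <-] jB]; first exact: ltW.
apply/ltW/dist_lt; rewrite mulr_ge0 ?ler0n ?(ltW t0)//=.
apply: (@le_lt_trans _ _ d'); last by rewrite /d'; lra.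
rewrite -kt ler_pM2r// ler_nat n_mono leqNgt; apply/negP => kj.
have : B < (n k.+1)%:R * t.
  by move: Mk; rewrite ltr_pdivrMr// /t mulrAC mulrA.
apply/negP; rewrite -leNgt; apply: le_trans jB.
by rewrite ler_pM2r// ler_nat n_mono.
Qed.

(** This makes [c_infty] finite as soon as it is not [+oo], and keeps
    [pi / (c_infty + 1)] within [(0, pi / 2]]. *)
Lemma c_infty_ge1 : (1 <= c_infty R n)%E.
Proof.
rewrite leNgt; apply/negP => /limf_esup_lt_near[K _ /(_ K (leqnn _))] /=.
by rewrite lte_fin ltr_pdivrMr// mul1r ltr_nat ltnNge ltnW.
Qed.

(** The limit superior itself need not be an eventual bound of the ratios, but
    every larger real is; the bound passes to the limit from the right. *)
Lemma alpha_ge_c_infty : (c_infty R n < +oo)%E ->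
  ((2 * sin (pi / (fine (c_infty R n) + 1)))%:E <= alpha R (range n))%E.
Proof.
move=> coo; have := c_infty_ge1; set c := fine _.
have cE : c_infty R n = c%:E.
  by rewrite fineK// ge0_fin_numE// (le_trans _ c_infty_ge1).
rewrite cE lee_fin => c1.
have fcvg : (2 * sin (pi / (x + 1)))%:E @[x --> c^'+]
    --> (2 * sin (pi / (c + 1)))%:E.
  apply: cvg_EFin; first exact: nearW.
  apply: cvgM; first exact: cvg_cst.
  apply: (@cvg_comp _ _ _ (fun x : R => pi / (x + 1)) sin);
    last exact: continuous_sin.
  apply: cvgM; first exact: cvg_cst.
  apply: cvgV; first by apply/eqP; lra.
  by apply: cvg_at_right_filter; apply: cvgD; [exact: cvg_id | exact: cvg_cst].
apply: (cvge_to_le fcvg); near=> x.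
have cx : c < x by near: x; exact: nbhs_right_gt.
apply: alpha_ge_of_ratio_le; first lra.
have : (c_infty R n < x%:E)%E by rewrite cE lte_fin.
by move=> /limf_esup_lt_near; apply: filterS => k; rewrite lte_fin => /ltW.
Unshelve. all: end_near. Qed.

Lemma alpha_gt0 : (c_infty R n < +oo)%E -> (0 < alpha R (range n))%E.
Proof.
move=> coo; apply: lt_le_trans (alpha_ge_c_infty coo).
have c1 : 1 <= fine (c_infty R n).
  by rewrite -lee_fin fineK ?c_infty_ge1// ge0_fin_numE// (le_trans _ c_infty_ge1).
have pi0 := pi_gt0 R.
rewrite lte_fin mulr_gt0// sin_gt0_pi// divr_gt0//=; last lra.
by rewrite ltr_pdivrMr; [nra|lra].
Qed.

End IncreasingSequence.

Theorem proposition6p3 (R : realType) (n : nat -> nat)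
  (n_pos : forall k : nat, (0 < n k)%N)
  (n_incr : forall k : nat, (n k < n k.+1)%N) :
  [/\ (c_infty R n < +oo)%E ->
        ((2 * sin (pi / (fine (c_infty R n) + 1)))%:E
          <= alpha R (range n))%E,
      c_infty R n = +oo%E -> alpha R (range n) = 0%E
    & (0 < alpha R (range n))%E <-> (c_infty R n < +oo)%E].
Proof.
have alpha0 : c_infty R n = +oo%E -> alpha R (range n) = 0%E.
  move=> coo; apply: alpha_eq0_of_ratio_unbounded => // M K.
  have Mlt : (M%:E < c_infty R n)%E by rewrite coo ltry.
  have infK : \oo [set k | (K <= k)%N] by exists K.
  have [k Kk] := lt_limf_esup_frequently Mlt infK.
  by rewrite lte_fin; exists k.
split=> //; first exact: alpha_ge_c_infty.
split=> [a0|]; last exact: alpha_gt0.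
by rewrite ltey; apply/eqP => /alpha0 a00; move: a0; rewrite a00 ltxx.
Qed.
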